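(* For every integer $n\ge 4$, $$\beta_b(\overrightarrow{C}(n;1,2)) = \beta_b(\overrightarrow{C}(n;1,-(n-2))) = \mathrm{diam}(\overrightarrow{C}(n;1,2)) = \left\lfloor\frac{n}{2}\right\rfloor.$$
   Context: For integers $n\ge 3$ and $b_1,\dots,b_k$, the oriented circulant graph $\overrightarrow{C}(n;b_1,\dots,b_k)$ has vertex set $\{v_0,\dots,v_{n-1}\}$ and arc set $\{v_iv_{i+b_j} : 0\le i\le n-1,\ 1\le j\le k\}$, with subscripts taken modulo $n$ (negative $b_j$ allowed). $d(u,v)$ is the length of a shortest directed path from $u$ to $v$; $e(v)=\max_u d(v,u)$ is the eccentricity; $\mathrm{diam}$ is the maximum eccentricity. An independent broadcast on an oriented graph $\overrightarrow{G}$ is a function $f:V(\overrightarrow{G})\to\{0,\dots,\mathrm{diam}(\overrightarrow{G})\}$ with $f(v)\le e(v)$ for all $v$, and $d(u,v)>f(u)$ for all distinct $u,v$ with $f(u),f(v)>0$. Its cost is $\sigma(f)=\sum_v f(v)$, and $\beta_b(\overrightarrow{G})$ is the maximum cost of an independent broadcast on $\overrightarrow{G}$. *)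

(* Defs.v *)
From mathcomp Require Import all_boot all_order all_algebra.

Set Implicit Arguments.
Unset Strict Implicit.
Unset Printing Implicit Defensive.

Import Order.TTheory GRing.Theory Num.Theory.

(* A digraph is given by its finite vertex type and its boolean arc relation. *)

Definition has_dipath (V : finType) (arc : rel V) (u v : V) (k : nat) : bool :=
  [exists p : k.-tuple V,
    [&& path arc u p, uniq (u :: p) & last u p == v]].

(* A directed path has fewer than #|V| arcs, so the search is exhaustive; it
   returns #|V|, in place of infinity, exactly when v is not reachable from u
   (lemma dist_lt_card below). *)
Definition dist (V : finType) (arc : rel V) (u v : V) : nat :=
  find (has_dipath arc u v) (iota 0 #|V|).

Definition ecc (V : finType) (arc : rel V) (v : V) : nat :=
  \max_(u : V) dist arc v u.

Definition diam (V : finType) (arc : rel V) : nat :=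
  \max_(v : V) ecc arc v.

Definition independent_broadcast (V : finType) (arc : rel V)
    (f : {ffun V -> 'I_(diam arc).+1}) : bool :=
  [forall v, f v <= ecc arc v] &&
  [forall u, forall v,
    [&& u != v, 0 < f u & 0 < f v] ==> (f u < dist arc u v)].

Definition cost (V : finType) (m : nat) (f : {ffun V -> 'I_m}) : nat :=
  \sum_(v : V) f v.

(* The zero function is an independent broadcast, so this maximum is attained. *)
Definition beta_b (V : finType) (arc : rel V) : nat :=
  \max_(f : {ffun V -> 'I_(diam arc).+1} | independent_broadcast f) cost f.

Definition circulant (n : nat) (bs : seq int) : rel 'I_n :=
  [rel i j : 'I_n |
    has (fun b : int => ((j : nat)%:Z == (i : nat)%:Z + b %[mod n%:Z])%Z) bs].
Arguments circulant : clear implicits.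

Lemma dist_lt_card (V : finType) (arc : rel V) (u v : V) :
  (dist arc u v < #|V|) = connect arc u v.
Proof.
rewrite /dist -{2}(size_iota 0 #|V|) -has_find.
apply/hasP/connectP => [[k _ /existsP [p /and3P [pp _ /eqP <-]]]|[p pp ->]].
  by exists p.
case/shortenP: pp => p' pp' up' _; exists (size p').
  rewrite mem_iota leq0n add0n /=.
  by have := max_card (mem (u :: p')); rewrite (card_uniqP up').
by apply/existsP; exists (in_tuple p'); rewrite pp' up' eqxx.
Qed.

(* Main.v *)
(** A single vertex of maximum eccentricity, broadcasting at full strength,
    gives diam <= beta_b. Conversely, in C(n;1,2) the vertex at cyclic offset j
    from u is at distance at most the ceiling of j/2, so in an independent
    broadcast the cyclic intervals [v, v + 2 f(v)) are pairwise disjoint, whence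
    2 sigma(f) <= n. Finally -(n-2) = 2 mod n, so both graphs have the same
    arcs. *)

Require Import Defs.
From mathcomp Require Import all_boot all_order all_algebra.
From mathcomp Require Import zify.

Set Implicit Arguments.
Unset Strict Implicit.
Unset Printing Implicit Defensive.

Section Digraph.
Variables (V : finType) (arc : rel V).

(** A walk may repeat vertices, whereas [has_dipath] asks for a simple path. Shortening the walk
    gives one, of length below [#|V|], hence within the range of the search. *)
Lemma dist_le_size u p : path arc u p -> dist arc u (last u p) <= size p.
Proof.
case/shortenP => p' pp' up' sub.
have le_p'p : size p' <= size p.
  by apply: uniq_leq_size (sub); case/andP: up'.
apply: leq_trans le_p'p; rewrite leqNgt; apply/negP => lt_dist.
have lt_card : size p' < #|V|.
  by have := max_card (mem (u :: p')); rewrite (card_uniqP up').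
have := before_find 0 lt_dist; rewrite nth_iota // => /negbT/negP; apply.
by apply/existsP; exists (in_tuple p'); rewrite pp' up' eqxx.
Qed.

(** The bound [k <= #|V|] covers the default value of [dist] when [v] is unreachable; otherwise the
    search returns the length of an actual path. *)
Lemma dist_geP u v k : k <= #|V| ->
  (forall p, path arc u p -> last u p = v -> k <= size p) ->
  k <= dist arc u v.
Proof.
move=> k_le walk_ge; have [lt_dV|/(leq_trans k_le)//] := ltnP (dist arc u v) #|V|.
have: has (has_dipath arc u v) (iota 0 #|V|) by rewrite has_find size_iota.
move/(nth_find 0); rewrite -/(dist arc u v) nth_iota //.
case/existsP => p /and3P[pp _ /eqP p_last].
by have := walk_ge _ pp p_last; rewrite size_tuple.
Qed.

Lemma dist_le_ecc u v : dist arc u v <= ecc arc u.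
Proof. exact: (@leq_bigmax _ (dist arc u)). Qed.

Lemma ecc_le_diam v : ecc arc v <= diam arc.
Proof. exact: (@leq_bigmax _ (ecc arc)). Qed.

Lemma diam_le_beta_b : diam arc <= beta_b arc.
Proof.
have [V0|V_gt0] := posnP #|V|.
  rewrite {1}/diam big1 // => v _.
  by have := card0_eq V0 v; rewrite inE.
have [w w_max] := @eq_bigmax _ (ecc arc) V_gt0.
pose f := [ffun v : V => if v == w then ord_max else (ord0 : 'I_(diam arc).+1)].
have f_indep : independent_broadcast f.
  apply/andP; split.
    apply/forallP => v; rewrite ffunE; case: eqP => [->|] //=.
    by rewrite /diam w_max.
  (* No two distinct vertices are both positive, so the distance condition is vacuous. *)
  apply/forallP => u; apply/forallP => v; rewrite !ffunE.
  by apply/implyP; case: (u =P w) => [->|]; case: (v =P w) => [->|] //=;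
    rewrite ?eqxx ?andbF.
apply: leq_trans (leq_bigmax_cond _ f_indep).
by rewrite /cost (bigD1 w) //= ffunE eqxx leq_addr.
Qed.

End Digraph.

Lemma ord_pos n (i : 'I_n) : 0 < n.
Proof. exact: leq_ltn_trans (leq0n i) (ltn_ord i). Qed.

(** Rotation by [j]; the vertex itself supplies [0 < n], so [n] need not be a syntactic
    successor. *)
Definition shift n (i : 'I_n) (j : nat) : 'I_n :=
  Ordinal (ltn_pmod (i + j) (ord_pos i)).

Lemma shift0 n (i : 'I_n) : shift i 0 = i.
Proof. by apply: val_inj; rewrite /= addn0 modn_small. Qed.

Lemma shiftD n (i : 'I_n) j k : shift (shift i j) k = shift i (j + k).
Proof. by apply: val_inj; rewrite /= modnDml addnA. Qed.

Lemma shift_inj n (i : 'I_n) j k :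
  j < n -> k < n -> shift i j = shift i k -> j = k.
Proof.
move=> j_lt k_lt /(congr1 val) /= /eqP.
by rewrite eqn_modDl !modn_small // => /eqP.
Qed.

Lemma shift_cancel n (u v : 'I_n) i j :
  j <= i -> shift u i = shift v j -> v = shift u (i - j).
Proof.
move=> le_ji /(congr1 val) /= /eqP; rewrite -{1}(subnK le_ji) addnA eqn_modDr.
by rewrite (modn_small (ltn_ord v)) => /eqP vE; apply: val_inj.
Qed.

Section CirculantOneTwo.
Variables (n : nat) (arc : rel 'I_n).
(** Abstracting the arc relation lets the results below apply to both circulant graphs. *)
Hypothesis arcE : forall u v, arc u v = (v == shift u 1) || (v == shift u 2).

(** Take arcs of length 2, ending with one of length 1 when [j] is odd. *)
Lemma dist_shift_le u j : dist arc u (shift u j) <= uphalf j.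
Proof.
suff [p pp [<- <-]] : exists2 p, path arc u p &
    last u p = shift u j /\ size p = uphalf j.
  exact: dist_le_size.
elim/ltn_ind: j u => -[|[|j]] IHj u.
- by exists [::]; rewrite ?shift0.
- by exists [:: shift u 1]; rewrite //= arcE eqxx.
have [|p pp [p_last p_size]] := IHj j _ (shift u 2); first by rewrite ltnS leqnSn.
exists (shift u 2 :: p); first by rewrite /= arcE eqxx orbT.
by rewrite /= p_last shiftD p_size.
Qed.

Lemma walk_shift u p : path arc u p ->
  exists2 j, j <= (size p).*2 & last u p = shift u j.
Proof.
elim: p u => [|v p IHp] u /=; first by exists 0; rewrite ?shift0.
case/andP; rewrite arcE => uv /IHp [j j_le ->].
by case/orP: uv => /eqP ->; [exists (1 + j) | exists (2 + j)];
  rewrite ?shiftD //= doubleS ltnS // ltnW.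
Qed.

Lemma ecc_le_half u : ecc arc u <= n./2.
Proof.
apply/bigmax_leqP => v _.
(* Adding [n] first keeps the natural subtraction from truncating. The offset is at most [n - 1],
   and [uphalf (n - 1)] is [n./2]. *)
have -> : v = shift u ((v + n - u) %% n).
  apply: val_inj; rewrite /= modnDmr subnKC; last by have := ltn_ord u; lia.
  by rewrite modnDr modn_small.
apply: leq_trans (dist_shift_le _ _) _.
have := ltn_pmod (v + n - u) (ord_pos u).
by move: (_ %% n) => k; lia.
Qed.

Lemma half_le_diam : n./2 <= diam arc.
Proof.
have [n0|n_gt0] := posnP n; first by have -> : n./2 = 0 by lia.
pose u := Ordinal n_gt0.
apply: leq_trans (ecc_le_diam arc u).
apply: leq_trans (dist_le_ecc arc u (shift u n.-1)).
apply: dist_geP => [|p /walk_shift[j j_le ->] /(congr1 val)].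
  by rewrite card_ord; lia.
rewrite /= !add0n (modn_small (_ : n.-1 < n)) ?ltn_predL // => jE.
(* From [j %% n = n - 1] follows [n - 1 <= j], while [j] is at most twice the length of the walk. *)
have := leq_mod j n; lia.
Qed.

Lemma diam_circulant : diam arc = n./2.
Proof.
apply/eqP; rewrite eqn_leq half_le_diam andbT.
by apply/bigmax_leqP => v _; apply: ecc_le_half.
Qed.

Lemma cost_le_half (f : {ffun 'I_n -> 'I_(diam arc).+1}) :
  independent_broadcast f -> cost f <= n./2.
Proof.
case/andP => /forallP f_ecc /forallP f_dist.
have f_le v : (f v).*2 <= n.
  by rewrite -geq_half_double; apply: leq_trans (f_ecc v) (ecc_le_half v).
(* The intervals are encoded as pairs of a centre and an offset; [f_le] ensures that every offset
   fits in ['I_n]. Disjointness becomes injectivity of [shift] on [A]. *)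
pose A := [set x : 'I_n * 'I_n | x.2 < (f x.1).*2].
(* If the intervals meet, [v] lies at offset [i - j < 2 f(u)] from [u], hence within distance [f u],
   which independence forbids for distinct positive vertices. *)
have overlap u v i j : j <= i -> i < (f u).*2 -> j < (f v).*2 ->
    shift u i = shift v j -> u = v.
  move=> le_ji i_lt j_lt /(shift_cancel le_ji) vE; apply/eqP/negPn/negP => neq_uv.
  have /forallP/(_ v)/implyP := f_dist u.
  have fu_gt0 : 0 < f u by lia.
  have fv_gt0 : 0 < f v by lia.
  rewrite neq_uv fu_gt0 fv_gt0 ltnNge => /(_ isT)/negP; apply.
  rewrite vE; apply: leq_trans (dist_shift_le _ _) _; rewrite leq_uphalf_double.
  exact: leq_trans (leq_subr _ _) (ltnW i_lt).
have inj_A : {in A &, injective (fun x : 'I_n * 'I_n => shift x.1 x.2)}.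
  move=> [u i] [v j]; rewrite !inE /= => i_lt j_lt eq_s.
  have eq_uv : u = v.
    have [le_ji|lt_ij] := leqP j i; first exact: overlap le_ji i_lt j_lt eq_s.
    by apply/esym; apply: overlap (ltnW lt_ij) j_lt i_lt (esym eq_s).
  by move: eq_s; rewrite eq_uv => /shift_inj eq_ij; congr (_, _);
    apply: val_inj; apply: eq_ij.
have : #|A| <= n.
  by rewrite -(card_in_imset inj_A) -[leqRHS]card_ord max_card.
have -> : #|A| = (cost f).*2; last by lia.
(* The trivial conjunct gives the predicate the shape that [pair_big_dep] needs to split the count
   by centres. *)
rewrite -sum1_card (eq_bigl (fun x : 'I_n * 'I_n => true && (x.2 < (f x.1).*2))).
  rewrite -(pair_big_dep xpredT (fun v (j : 'I_n) => j < (f v).*2) (fun _ _ => 1)) /=.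
  rewrite /cost -mul2n big_distrr /=; apply: eq_bigr => v _.
  by rewrite -(big_ord_widen _ (fun=> 1) (f_le v)) sum1_card card_ord mul2n.
by move=> x; rewrite inE.
Qed.

Lemma beta_b_circulant : beta_b arc = n./2.
Proof.
apply/eqP; rewrite eqn_leq -{2}diam_circulant diam_le_beta_b andbT.
by apply/bigmax_leqP => f; apply: cost_le_half.
Qed.

End CirculantOneTwo.

Lemma eq_shift_modz n (u v : 'I_n) (b : int) (k : nat) : (b = k%:Z %[mod n%:Z])%Z ->
  ((v : nat)%:Z == ((u : nat)%:Z + b)%R %[mod n%:Z])%Z = (v == shift u k).
Proof.
move=> bE; rewrite -modzDmr bE modzDmr -PoszD !modz_nat eqz_nat.
by rewrite (modn_small (ltn_ord v)).
Qed.

Lemma circulantE n (b : int) (u v : 'I_n) : (b = 2%:Z %[mod n%:Z])%Z ->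
  circulant n [:: 1%Z; b] u v = (v == shift u 1) || (v == shift u 2).
Proof.
move=> bE; rewrite /circulant /= orbF.
by rewrite (@eq_shift_modz _ _ _ _ 1) // (eq_shift_modz _ _ bE).
Qed.

Theorem theorem5 (n : nat) (hn : 4 <= n) :
  [/\ beta_b (circulant n [:: 1%Z; 2%Z])
        = beta_b (circulant n [:: 1%Z; (- (n%:Z - 2%:Z))%R]),
      beta_b (circulant n [:: 1%Z; (- (n%:Z - 2%:Z))%R])
        = diam (circulant n [:: 1%Z; 2%Z])
    & diam (circulant n [:: 1%Z; 2%Z]) = n %/ 2].
Proof.
have arc2 u v := @circulantE n 2%Z u v erefl.
have arcN u v : circulant n [:: 1%Z; (- (n%:Z - 2%:Z))%R] u v
    = (v == shift u 1) || (v == shift u 2).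
  (* The target 2 is rewritten as [(2 - n) + n], whose last term vanishes modulo [n]. *)
  by apply: circulantE; rewrite GRing.opprB -[in RHS](GRing.subrK (Posz n) (Posz 2)) modzDr.
by rewrite (beta_b_circulant arc2) (beta_b_circulant arcN) (diam_circulant arc2) divn2.
Qed.
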